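(* Let $\alpha>0$, $\theta\in\mathbb{R}$ and $-\infty<\beta<1$, and let $\Gamma_{\alpha,\theta}=\{n^\alpha e^{2\pi n\theta\sqrt{-1}} \mid n\in\mathbb{Z}_{\ge 0}\}\subset\mathbb{C}$. Suppose that $1+2\alpha\beta=2\alpha$. If $\Gamma_{\alpha,\theta}$ is asymptotically $\beta$-relatively dense or asymptotically $\beta$-uniformly discrete, then $\theta\notin\mathbb{Q}$.
   Context: For a point set $\Gamma\subset\mathbb{C}$ put $\Gamma'=\{\gamma\in\Gamma \mid |\gamma|\ge 1\}$. Let $-\infty<\beta<1$. $\Gamma$ is called asymptotically $\beta$-relatively dense if there exists $r>0$ satisfying one (equivalently, all) of the following three conditions, which are mutually equivalent for each fixed $r$: (i) for any $r_1>r$ there exists $M_1>0$ such that for any $z\in\mathbb{C}$ with $|z|\ge M_1$ there exists $\zeta\in\Gamma'$ with $|z-\zeta|<r_1|z|^\beta$; (ii) for any $r_2>r$ there exists $M_2>0$ such that for any $z\in\mathbb{C}$ with $|z|\ge M_2$ there exists $\zeta\in\Gamma'$ with $|z-\zeta|<r_2|\zeta|^\beta$; (iii) for any $r_3>r$ there exists $M_3>0$ such that for any $z\in\mathbb{C}$ with $|z|\ge M_3$ there exists $\zeta\in\Gamma'$ with $|z-\zeta|<\frac{r_3}{2}(|z|^\beta+|\zeta|^\beta)$. A locally finite set $\Gamma$ (i.e. $\#\{\zeta\in\Gamma \mid |\zeta|<r\}<\infty$ for every $r>0$) is called asymptotically $\beta$-uniformly discrete if there exists $s>0$ satisfying one (equivalently,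 all) of the following three conditions, which are mutually equivalent for each fixed $s$: (i) for any $0<s_1<s$ there exists $M_1>0$ such that for any $z\in\mathbb{C}$ with $|z|\ge M_1$, $\#\{\zeta\in\Gamma' \mid |z-\zeta|<s_1|z|^\beta\}\le 1$; (ii) for any $0<s_2<s$ there exists $M_2>0$ such that for any $z\in\mathbb{C}$ with $|z|\ge M_2$, $\#\{\zeta\in\Gamma' \mid |z-\zeta|<s_2|\zeta|^\beta\}\le 1$; (iii) for any $0<s_3<s$ there exists $M_3>0$ such that for any $z\in\mathbb{C}$ with $|z|\ge M_3$, $\#\{\zeta\in\Gamma' \mid |z-\zeta|<\frac{s_3}{2}(|z|^\beta+|\zeta|^\beta)\}\le 1$. *)

(* Defs.v *)
From HB Require Import structures.
From mathcomp Require Import all_boot all_order all_algebra.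
From mathcomp Require Import all_classical all_reals all_analysis.
From mathcomp.real_closed Require Export complex.

Set Implicit Arguments.
Unset Strict Implicit.
Unset Printing Implicit Defensive.

Import Order.TTheory GRing.Theory Num.Theory.
(* The norm of R[i] takes its values in R[i]; [normc : R[i] -> R] is the modulus
   as a real number. *)
Export ComplexField.Normc.

Local Open Scope classical_set_scope.
Local Open Scope card_scope.
Local Open Scope complex_scope.
Local Open Scope ring_scope.

Section AsymptoticDelone.
Variable R : realType.
Implicit Types (beta r s : R) (G : set R[i]).

Definition outer_part G : set R[i] := [set g | G g /\ 1 <= normc g].

Definition rel_dense_i beta r G : Prop :=
  forall r1, r < r1 -> exists2 M1 : R, 0 < M1 &
    forall z : R[i], M1 <= normc z ->
      exists2 w, outer_part G w & normc (z - w) < r1 * normc z `^ beta.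

Definition rel_dense_ii beta r G : Prop :=
  forall r2, r < r2 -> exists2 M2 : R, 0 < M2 &
    forall z : R[i], M2 <= normc z ->
      exists2 w, outer_part G w & normc (z - w) < r2 * normc w `^ beta.

Definition rel_dense_iii beta r G : Prop :=
  forall r3, r < r3 -> exists2 M3 : R, 0 < M3 &
    forall z : R[i], M3 <= normc z ->
      exists2 w, outer_part G w &
        normc (z - w) < r3 / 2 * (normc z `^ beta + normc w `^ beta).

(* For beta < 1 the three conditions are equivalent for each fixed r, so the
   disjunction amounts to any one of them; likewise for uniform discreteness. *)
Definition asymptotically_relatively_dense beta G : Prop :=
  exists2 r, 0 < r &
    [\/ rel_dense_i beta r G, rel_dense_ii beta r G | rel_dense_iii beta r G].

Definition unif_discrete_i beta s G : Prop :=
  forall s1, 0 < s1 -> s1 < s -> exists2 M1 : R, 0 < M1 &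
    forall z : R[i], M1 <= normc z ->
      [set w | outer_part G w /\ normc (z - w) < s1 * normc z `^ beta] #<= `I_1.

Definition unif_discrete_ii beta s G : Prop :=
  forall s2, 0 < s2 -> s2 < s -> exists2 M2 : R, 0 < M2 &
    forall z : R[i], M2 <= normc z ->
      [set w | outer_part G w /\ normc (z - w) < s2 * normc w `^ beta] #<= `I_1.

Definition unif_discrete_iii beta s G : Prop :=
  forall s3, 0 < s3 -> s3 < s -> exists2 M3 : R, 0 < M3 &
    forall z : R[i], M3 <= normc z ->
      [set w | outer_part G w /\
        normc (z - w) < s3 / 2 * (normc z `^ beta + normc w `^ beta)] #<= `I_1.

Definition locally_finite_set G : Prop :=
  forall r, 0 < r -> finite_set [set w | G w /\ normc w < r].

Definition asymptotically_uniformly_discrete beta G : Prop :=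
  locally_finite_set G /\
  exists2 s, 0 < s &
    [\/ unif_discrete_i beta s G, unif_discrete_ii beta s G
      | unif_discrete_iii beta s G].

Definition cis (t : R) : R[i] := cos t +i* sin t.

(* Since alpha > 0, the point of index 0 is 0 `^ alpha = 0. *)
Definition spiral_set (alpha theta : R) : set R[i] :=
  [set (n%:R `^ alpha)%:C * cis (2 * pi * n%:R * theta) | n in [set: nat]].

End AsymptoticDelone.

(* Main.v *)
Require Import Defs.
From mathcomp Require Import all_boot all_order all_algebra.
From mathcomp Require Import all_classical all_reals all_analysis.
From mathcomp Require Import ring lra.

(** Suppose that [theta] equals [p / q]. Then the argument of the [n]-th point
    of the spiral depends only on [n] modulo [q], so the whole set lies on the
    [q] rays [w ^+ q >= 0]. Both properties fail for such a set.

    Relative density fails because the rays leave out whole sectors. A point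
    [z] on the bisecting direction [cis (pi / q)] satisfies
    [z ^+ q = - `|z| ^+ q], so its distance to every point [w] of the rays is
    at least [Num.max `|z| `|w| / q] ([max_normc_le_dist]). Since [beta < 1],
    the permitted distance, of order [`|z| `^ beta + `|w| `^ beta], is
    negligible against this bound once [`|z|] is large ([powR_sublinear]).

    Uniform discreteness fails because the points crowd along a ray. On the
    positive real ray lie the points [n `^ alpha] with [n] a multiple of [q].
    The gap between two consecutive ones has order [n `^ (alpha - 1)], while
    the separation demanded at [n `^ alpha] has order
    [n `^ (alpha * beta) = n `^ (alpha - 2^-1)], by the relation between
    [alpha] and [beta]; the gap is therefore eventually too small
    ([powR_gap]).

    The three variants of each property are handled at once, through a single
    consequence that they share ([rel_dense_sum_bound] and
    [unif_discrete_separation]). *)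

Import Order.TTheory GRing.Theory Num.Theory.

Local Open Scope complex_scope.
Local Open Scope ring_scope.

(** * Unit complex numbers and moduli *)

Lemma cisD (R : realType) (s t : R) : cis (s + t) = cis s * cis t.
Proof.
rewrite /cis cosD sinD; apply/eqP; rewrite eq_complex /=.
by rewrite eqxx /= addrC.
Qed.

Lemma cis0 (R : realType) : cis (0 : R) = 1.
Proof. by rewrite /cis cos0 sin0. Qed.

Lemma cisMn (R : realType) (t : R) n : cis (t *+ n) = cis t ^+ n.
Proof.
by elim: n => [|n IHn]; rewrite ?mulr0n ?cis0 // mulrS cisD IHn exprS.
Qed.

Lemma cis_2pi_int (R : realType) (k : int) : cis (2 * pi * k%:~R : R) = 1.
Proof.
have cis_nat n : cis (2 * pi * n%:R : R) = 1.
  rewrite mulr_natr cisMn mulr_natl /cis cos2pi sin2pi.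
  exact: expr1n.
case: k => n; first exact: cis_nat.
rewrite NegzE mulrNz mulrN -[LHS]mulr1 -{1}(cis_nat n.+1) -cisD addNr.
exact: cis0.
Qed.

Lemma normc_real (R : realType) (x : R) : 0 <= x -> normc x%:C = x.
Proof. by move=> x0; rewrite /= expr0n /= addr0 sqrtr_sqr ger0_norm. Qed.

Lemma normc_ge0 (R : realType) (z : R[i]) : 0 <= normc z.
Proof. by case: z => a b; exact: sqrtr_ge0. Qed.

Lemma normc_cis (R : realType) (t : R) : normc (cis t) = 1.
Proof. by rewrite /= cos2Dsin2 sqrtr1. Qed.

Lemma normc_real_cis (R : realType) (x t : R) : 0 <= x ->
  normc (x%:C * cis t) = x.
Proof. by move=> x0; rewrite normcM normc_real // normc_cis mulr1. Qed.

Lemma normc_distC (R : realType) (z w : R[i]) : normc (z - w) = normc (w - z).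
Proof. by rewrite -[RHS]normcN opprB. Qed.

(** * Rational spirals leave out sectors *)

(** Telescoping: passing from one exponent to the next costs one more factor
    [x - y] multiplied by [n] factors bounded by [m]. *)
Lemma ler_distXn (K : numDomainType) (m x y : K) n : `|x| <= m -> `|y| <= m ->
  `|x ^+ n.+1 - y ^+ n.+1| <= n.+1%:R * m ^+ n * `|x - y|.
Proof.
move=> xm ym; have m0 : 0 <= m by exact: le_trans xm.
elim: n => [|n IHn]; first by rewrite expr0 !mul1r.
have -> : x ^+ n.+2 - y ^+ n.+2
    = x ^+ n.+1 * (x - y) + (x ^+ n.+1 - y ^+ n.+1) * y by rewrite !exprSr; ring.
apply: le_trans (ler_normD _ _) _; rewrite !normrM.
have -> : n.+2%:R * m ^+ n.+1 * `|x - y|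
    = m ^+ n.+1 * `|x - y| + n.+1%:R * m ^+ n * `|x - y| * m.
  by rewrite -[n.+2%:R]natr1 exprSr; ring.
apply: lerD; last by rewrite ler_pM.
by rewrite ler_wpM2r // normrX lerXn2r.
Qed.

(** Two points lying on rays whose [q]-th powers are opposite are far apart:
    [z ^+ q - w ^+ q] has modulus [`|z| ^+ q + `|w| ^+ q], and it has [z - w]
    as a factor. *)
Lemma max_normc_le_dist (R : realType) (q : nat) (z w : R[i]) : (0 < q)%N ->
    z ^+ q = - (normc z ^+ q)%:C -> w ^+ q = (normc w ^+ q)%:C ->
  Num.max (normc z) (normc w) <= q%:R * normc (z - w).
Proof.
case: q => // n _ zq wq; set m := Num.max _ _.
have zm : normc z <= m by rewrite le_max lexx.
have wm : normc w <= m by rewrite le_max lexx orbT.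
have m0 : 0 <= m := le_trans (normc_ge0 _ z) zm.
have: m ^+ n.+1 <= n.+1%:R * m ^+ n * normc (z - w).
  apply: (@le_trans _ _ (normc (z ^+ n.+1 - w ^+ n.+1))).
    rewrite zq wq -opprD normcN -rmorphD normc_real; last first.
      by rewrite addr_ge0 ?exprn_ge0 ?normc_ge0.
    rewrite /m; case: (leP (normc z)) => _;
      by rewrite ?lerDl ?lerDr exprn_ge0 ?normc_ge0.
  have := @ler_distXn _ m%:C z w n; rewrite /Num.norm /= !lecR.
  move=> /(_ zm wm).
  by rewrite -(rmorph_nat (real_complex R)) -!(rmorphXn, rmorphM) /= lecR.
have [m_gt0|] := ltP 0 m; last first.
  by move=> m_le0 _; apply: (le_trans m_le0); rewrite mulr_ge0 ?normc_ge0.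
by rewrite exprSr mulrAC mulrC ler_pM2r // exprn_gt0.
Qed.

(** Raising to the power [q] multiplies the argument of the [n]-th point by
    [q], which turns it into a multiple of [2 * pi]. *)
Lemma spiral_set_expr (R : realType) (alpha theta : R) (p : int) (q : nat)
    (w : R[i]) : theta * q%:R = p%:~R ->
  spiral_set alpha theta w -> w ^+ q = (normc w ^+ q)%:C.
Proof.
move=> thq [n _ <-]; rewrite normc_real_cis ?powR_ge0 //.
rewrite exprMn -cisMn rmorphXn.
have -> : (2 * pi * n%:R * theta) *+ q = 2 * pi * (n%:Z * p)%:~R.
  by rewrite intrM -thq -mulr_natr; ring.
by rewrite cis_2pi_int mulr1.
Qed.

Lemma antipodal_expr (R : realType) (q : nat) (t : R) : (0 < q)%N -> 0 <= t ->
  let z := t%:C * cis (pi / q%:R) in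
  normc z = t /\ z ^+ q = - (normc z ^+ q)%:C.
Proof.
move=> q0 t0 z; rewrite /z normc_real_cis //; split=> //.
rewrite exprMn -cisMn -[_ *+ q]mulr_natr divfK ?pnatr_eq0 -?lt0n //.
rewrite rmorphXn -[RHS]mulrN1; congr (_ * _).
by rewrite /cis cospi sinpi; apply/eqP; rewrite eq_complex /= oppr0 !eqxx.
Qed.

(** * Failure of relative density *)

Lemma powR_ge1 (R : realType) (x r : R) : 1 <= x -> 0 <= r -> 1 <= x `^ r.
Proof. by move=> x1 r0; rewrite -[leLHS](powRr0 x) ler_powR. Qed.

Lemma powR_sublinear (R : realType) (b K : R) : b < 1 -> 0 < K ->
  exists2 M : R, 1 <= M & forall t, M <= t -> K * t `^ b < t.
Proof.
move=> b1 K0; have c0 : 0 < 1 - b by rewrite subr_gt0.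
exists ((K + 1) `^ (1 - b)^-1).
  by rewrite powR_ge1 ?invr_ge0 ?lerDr ?ltW.
move=> t Mt.
have M0 : 0 < (K + 1) `^ (1 - b)^-1 by rewrite powR_gt0 // addr_gt0.
have t0 : 0 < t by exact: lt_le_trans Mt.
have tE : t = t `^ (1 - b) * t `^ b.
  by rewrite -powRD ?(gt_eqF t0) ?implybT // subrK powRr1 // ltW.
rewrite [ltRHS]tE ltr_pM2r ?powR_gt0 //.
apply: (@lt_le_trans _ _ (K + 1)); first by rewrite ltrDl.
have := @ge0_ler_powR _ (1 - b) (ltW c0) _ _ (ltW M0) (ltW t0) Mt.
by rewrite -powRrM mulVf ?gt_eqF // powRr1 // addr_ge0 // ltW.
Qed.

(** Each of the three admissible radii is bounded by a multiple of
    [`|z| `^ beta + `|w| `^ beta]. *)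
Lemma rel_dense_sum_bound (R : realType) (beta : R) (G : set R[i]) :
  asymptotically_relatively_dense beta G ->
  exists K M : R, 0 < K /\ forall z : R[i], M <= normc z ->
    exists2 w, outer_part G w &
      normc (z - w) < K * (normc z `^ beta + normc w `^ beta).
Proof.
move=> [r r0 dense]; exists (r + 1).
have r1 : r < r + 1 by rewrite ltrDl.
have rr : 0 < r + 1 by exact: lt_trans r1.
case: dense => /(_ _ r1)[M _ HM]; exists M; split=> // z /HM [w Gw zw];
  exists w => //; apply: (lt_le_trans zw).
- by rewrite ler_pM2l // lerDl powR_ge0.
- by rewrite ler_pM2l // lerDr powR_ge0.
- rewrite ler_wpM2r ?addr_ge0 ?powR_ge0 //; lra.
Qed.

(** With [m] the larger of the two moduli, a point [w] close enough to a
    bisecting [z] would give [m <= 2 * q * K * m `^ b], which is impossible for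
    large [m]. *)
Lemma rational_spiral_not_dense (R : realType) (alpha theta beta : R)
    (p : int) (q : nat) : (0 < q)%N -> theta * q%:R = p%:~R -> beta < 1 ->
  ~ asymptotically_relatively_dense beta (spiral_set alpha theta).
Proof.
move=> q0 thq b1 /rel_dense_sum_bound [K [M [K0 dense]]].
(* For negative [beta] the function [x `^ beta] decreases; replacing [beta] by
   its positive part [b < 1] lets both powers be bounded by [m `^ b], because
   the moduli are at least 1. *)
pose b := Num.max beta 0.
have bb : beta <= b by rewrite le_max lexx.
have b0 : 0 <= b by rewrite le_max lexx orbT.
have b1' : b < 1 by rewrite gt_max b1 ltr01.
have qR : 0 < q%:R :> R by rewrite ltr0n.
have [T T1 HT] := @powR_sublinear R b (q%:R * (K * 2)) b1'
  ltac:(by rewrite !mulr_gt0).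
pose t := Num.max M T.
have Tt : T <= t by rewrite le_max lexx orbT.
have t0 : 0 <= t by rewrite (le_trans _ Tt) // (le_trans _ T1).
have [] := @antipodal_expr R q t q0 t0; set z := _ * _ => nz zq.
have [|w [Gw w1] zw] := dense z; first by rewrite nz le_max lexx.
have wq := spiral_set_expr _ _ _ _ _ _ thq Gw.
have far := max_normc_le_dist _ _ _ _ q0 zq wq.
set m := Num.max _ _ in far.
have zm : normc z <= m by rewrite le_max lexx.
have wm : normc w <= m by rewrite le_max lexx orbT.
have z1 : 1 <= normc z by rewrite nz (le_trans T1).
have powm x : 1 <= x -> x <= m -> x `^ beta <= m `^ b.
  move=> x1 xm; apply: (le_trans (ler_powR x1 bb)).
  have x0 : 0 <= x by exact: le_trans x1.
  by apply: ge0_ler_powR; rewrite ?nnegrE // (le_trans x0).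
have := HT m; rewrite -nz in Tt => /(_ (le_trans Tt zm)).
apply/negP; rewrite -leNgt (le_trans far) // -mulrA ler_pM2l //.
apply: (le_trans (ltW zw)); rewrite -mulrA ler_pM2l // mulr_natl mulr2n.
by rewrite lerD ?powm.
Qed.

(** * Failure of uniform discreteness *)

(** The convex function [(1 + h) ^+ n] lies below its chord on the unit
    interval. *)
Lemma expr1D_le (R : realDomainType) (h : R) (n : nat) : 0 <= h <= 1 ->
  (1 + h) ^+ n <= 1 + (2 ^+ n - 1) * h.
Proof.
move=> /andP[h0 h1]; elim: n => [|n IHn]; first by rewrite !expr0; lra.
rewrite exprSr; apply: (@le_trans _ _ ((1 + (2 ^+ n - 1) * h) * (1 + h))).
  by rewrite ler_wpM2r // addr_ge0.
have c0 : 0 <= (2 : R) ^+ n - 1 by rewrite subr_ge0 exprn_ege1 // ler1n.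
rewrite -subr_ge0 (_ : _ - _ = (2 ^+ n - 1) * (h * (1 - h))).
  by rewrite !mulr_ge0 // subr_ge0.
by rewrite exprS; ring.
Qed.

(** Writing [x + d = x * (1 + d / x)] and bounding the power of [1 + d / x] by
    an affine function shows that the increment is [O(x `^ (alpha - 1))], a
    factor [x `^ (- 2^-1)] smaller than the right-hand side. *)
Lemma powR_gap (R : realType) (alpha d e : R) : 0 <= d -> 0 < e ->
  exists X : R, forall x, X <= x ->
    (x + d) `^ alpha - x `^ alpha < e * x `^ (alpha - 2^-1).
Proof.
move=> d0 e0; pose N := (Num.trunc alpha).+1; pose c : R := 2 ^+ N * d / e.
have aN : alpha <= N%:R by rewrite ltW // truncnS_gt.
have c0 : 0 <= c by rewrite divr_ge0 ?mulr_ge0 ?exprn_ge0 // ltW.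
(* [d <= x] puts [d / x] in the unit interval; [c ^+ 2 < x] makes the factor
   [2 ^+ N * (d / x)] smaller than [e / Num.sqrt x]. *)
exists (d + 1 + c ^+ 2) => x Xx.
have c20 : 0 <= c ^+ 2 by rewrite exprn_ge0.
have x0 : 0 < x by lra.
have dx : 0 <= d / x <= 1.
  apply/andP; split; first exact: divr_ge0 d0 (ltW x0).
  by rewrite ler_pdivrMr //; lra.
have -> : x + d = x * (1 + d / x).
  by rewrite mulrDr mulr1 mulrCA divff ?gt_eqF ?mulr1.
have h0 : 0 <= 1 + d / x by rewrite addr_ge0 //; case/andP: dx.
have x0' := ltW x0.
rewrite powRM // powRB ?(gt_eqF x0) ?implybT // powR12_sqrt //.
have pw : (1 + d / x) `^ alpha <= 1 + (2 ^+ N - 1) * (d / x).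
  apply: le_trans (expr1D_le _ _ _ dx); rewrite -powR_mulrn //.
  by rewrite ler_powR // lerDl; case/andP: dx.
set s := Num.sqrt x; have s0 : 0 < s by rewrite sqrtr_gt0.
have xs : x = s ^+ 2 by rewrite sqr_sqrtr // ltW.
have cs : c < s.
  have : c ^+ 2 < s ^+ 2 by rewrite -xs; lra.
  by rewrite ltr_pXn2r // nnegrE ltW.
have cdx : 2 ^+ N * (d / x) < e / s.
  have -> : 2 ^+ N * (d / x) = c / s * (e / s).
    rewrite xs /c; field; by rewrite !gt_eqF.
  by rewrite gtr_pMl ?divr_gt0 // ltr_pdivrMr // mul1r.
rewrite mulrCA -[X in _ - X]mulr1 -mulrBr ltr_pM2l ?powR_gt0 //.
by case/andP: dx => dx _; lra.
Qed.

Lemma card_le_I1_eq (T : Type) (A : set T) (x y : T) :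
  (A #<= `I_1)%card -> A x -> A y -> x = y.
Proof.
move=> /pcard_leP[f] Ax Ay.
have f0 z : A z -> f z = 0%N.
  by move=> /(@funS _ _ A _ f) /=; case: (f z).
have finj : {in A &, injective f} := @inj _ _ A f.
by apply: finj; rewrite ?inE // !f0.
Qed.

(** In each variant one of the two points [v] and [w] serves as the centre of
    the disc, which then contains that point, and contains the other one as
    soon as they are close. The centre is chosen so that the power
    [`|v| `^ beta] occurs in the radius that the other point has to meet. *)
Lemma unif_discrete_separation (R : realType) (beta : R) (G : set R[i]) :
  asymptotically_uniformly_discrete beta G ->
  exists e M : R, 0 < e /\ forall v w, outer_part G v -> outer_part G w ->
    M <= normc v -> M <= normc w ->
    normc (w - v) < e * normc v `^ beta -> v = w.
Proof.
move=> [_ [s s0 disc]].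
(* The hypothesis is used with the parameter [s / 2]; variant (iii) halves it
   again. *)
exists (s / 2 / 2).
have s20 : 0 < s / 2 by lra.
have s2s : s / 2 < s by lra.
have pow_gt0 v : outer_part G v -> 0 < normc v `^ beta.
  by move=> [_ v1]; rewrite powR_gt0 // (lt_le_trans _ v1).
have nvv (v : R[i]) : normc (v - v) = 0 by rewrite subrr normc0.
case: disc => /(_ _ s20 s2s)[M _ HM]; exists M; split; rewrite ?divr_gt0 //;
  move=> v w Gv Gw Mv Mw vw; have pv := pow_gt0 _ Gv; have pw := pow_gt0 _ Gw.
- apply: (card_le_I1_eq _ _ _ _ (HM v Mv)); split; rewrite ?nvv ?mulr_gt0 //.
  by rewrite normc_distC (lt_trans vw) // ltr_pM2r //; lra.
- apply: (card_le_I1_eq _ _ _ _ (HM w Mw)); split; rewrite ?nvv ?mulr_gt0 //.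
  by rewrite (lt_trans vw) // ltr_pM2r //; lra.
- apply: (card_le_I1_eq _ _ _ _ (HM v Mv)); split; rewrite ?nvv
    ?mulr_gt0 ?addr_gt0 //.
  by rewrite normc_distC (lt_trans vw) // ltr_pM2l ?ltrDl // divr_gt0.
Qed.

Lemma spiral_set_real (R : realType) (alpha theta : R) (p : int) (q k : nat) :
  theta * q%:R = p%:~R ->
  spiral_set alpha theta ((k * q)%:R `^ alpha)%:C.
Proof.
move=> thq; exists (k * q)%N => //.
have -> : 2 * pi * (k * q)%:R * theta = 2 * pi * (k%:Z * p)%:~R.
  by rewrite intrM -thq natrM; ring.
by rewrite cis_2pi_int mulr1.
Qed.

Lemma rational_spiral_not_discrete (R : realType) (alpha theta beta : R)
    (p : int) (q : nat) : (0 < q)%N -> theta * q%:R = p%:~R -> 0 < alpha ->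
    1 + 2 * alpha * beta = 2 * alpha ->
  ~ asymptotically_uniformly_discrete beta (spiral_set alpha theta).
Proof.
move=> q0 thq a0 ab /unif_discrete_separation [e [M [e0 disc]]].
have qR : 0 < q%:R :> R by rewrite ltr0n.
have [X HX] := @powR_gap R alpha q%:R e (ltW qR) e0.
(* [L <= t] ensures that [t `^ alpha] is at least both 1 and [M], and that
   [powR_gap] applies at [t]. *)
pose L := 1 + `|M| `^ alpha^-1 + `|X|.
have pL : 0 <= `|M| `^ alpha^-1 by rewrite powR_ge0.
pose k := (Num.trunc L).+1.
pose x : R := (k * q)%:R; pose y : R := (k.+1 * q)%:R.
have Lx : L <= x.
  apply: (@le_trans _ _ k%:R); first by rewrite ltW ?truncnS_gt.
  by rewrite ler_nat leq_pmulr.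
have yx : y = x + q%:R by rewrite /y mulSn natrD addrC.
have large t : L <= t -> 1 <= t `^ alpha /\ M <= t `^ alpha.
  have nX := normr_ge0 X; have nM := ler_norm M.
  move=> Lt; have t1 : 1 <= t by rewrite /L in Lt; lra.
  split; first exact: powR_ge1 t1 (ltW a0).
  apply: (le_trans nM); rewrite -[leLHS]powRr1 //.
  rewrite -[X in _ `^ X](mulVf (lt0r_neq0 a0)) powRrM.
  apply: ge0_ler_powR; rewrite ?nnegrE //; first exact: ltW.
    exact: le_trans t1.
  by rewrite /L in Lt; lra.
have Ly : L <= y by rewrite yx (le_trans Lx) // lerDl ltW.
have [x1 Mx] := large _ Lx; have [y1 My] := large _ Ly.
have L0 : 0 < L by rewrite /L; have := normr_ge0 X; lra.
have x0 : 0 < x by exact: lt_le_trans Lx.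
have nc t : normc (t `^ alpha)%:C = t `^ alpha by rewrite normc_real // powR_ge0.
have xy_lt : x `^ alpha < y `^ alpha.
  apply: gt0_ltr_powR => //; rewrite ?nnegrE ?(ltW x0) //.
  by rewrite yx ltrDl.
have Xx : X <= x.
  by rewrite (le_trans _ Lx) // /L; have := ler_norm X; lra.
have xyE : (x `^ alpha)%:C = (y `^ alpha)%:C.
  apply: disc; rewrite ?nc //.
  - by split; rewrite ?nc //; exact: spiral_set_real thq.
  - by split; rewrite ?nc //; exact: spiral_set_real thq.
  rewrite -rmorphB normc_real; last by rewrite subr_ge0 ltW.
  rewrite -powRrM (_ : alpha * beta = alpha - 2^-1); last lra.
  by rewrite yx HX.
by move: xyE xy_lt => [->]; rewrite ltxx.
Qed.

Theorem lemma3 (R : realType) (alpha theta beta : R)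
    (alpha_gt0 : 0 < alpha) (beta_lt1 : beta < 1)
    (alpha_beta : 1 + 2 * alpha * beta = 2 * alpha) :
  asymptotically_relatively_dense beta (spiral_set alpha theta) \/
  asymptotically_uniformly_discrete beta (spiral_set alpha theta) ->
  irrational theta.
Proof.
move=> delone [x _ xtheta].
have q0 : (0 < `|denq x|)%N by rewrite absz_gt0 denq_neq0.
have thq : theta * `|denq x|%:R = (numq x)%:~R.
  rewrite -xtheta /ratr -[X in _ * X]/((`|denq x|%N : int)%:~R) absz_denq.
  by rewrite divfK // intr_eq0 denq_neq0.
by case: delone; [exact: rational_spiral_not_dense q0 thq beta_lt1
  | exact: rational_spiral_not_discrete q0 thq alpha_gt0 alpha_beta].
Qed.
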